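(* Let $\mathfrak g$ be a Lie algebra over $\mathbb K$, $E\in\mathfrak g$ an Euler operator, $D=\mathrm{ad}(E)$, with associated $3$-grading $\mathfrak g=\mathfrak g_1\oplus\mathfrak g_0\oplus\mathfrak g_{-1}$ and filtrations $\mathfrak f^\pm=\mathfrak f^\pm(D)$. Then: (1) The orbit of $D\in\mathcal G$ under $G$ is isomorphic to $M=G/H$ and the orbits of $\mathfrak f^{\mp}\in\mathcal F$ under $G$ are isomorphic to $X^\pm=G/P^\mp$; in other words, $$H=\{g\in G: g.(\mathfrak f^-,\mathfrak f^+)=(\mathfrak f^-,\mathfrak f^+)\},\qquad P^\pm=\{g\in G: g.\mathfrak f^\pm=\mathfrak f^\pm\}.$$ Moreover, $P^+\cap P^-=H$, $P^\pm\cap U^\mp=\{1\}$ and $$P^\pm=\{g\in G: gDg^{-1}-D\in\mathrm{ad}(\mathfrak g_{\pm1})\}=\{g\in G: g.E-E\in\mathfrak z(\mathfrak g)+\mathfrak g_{\pm1}\}.$$ (2) Identify $X^\pm$ with the orbits $G.\mathfrak f^\mp\subset\mathcal F$, $\mathcal G$ with the set of transversal pairs in $\mathcal F\times\mathcal F$, and $M$ with the orbit $G.(\mathfrak f^-,\mathfrak f^+)$. Then $\mathcal G\cap(X^+\times X^-)=M$. (3) For every $\mathfrak e=(\mathfrak e_1,\mathfrak e_0)\in X^-$, the set $\mathfrak e^\top$ is contained in $X^+$ and carries a well-defined structure of an affine space over $\mathbb K$ with translation group $\mathfrak e_1\cong\mathfrak g_1$ (acting by $x.\mathfrak f=e^{\mathrm{ad}\,x}.\mathfrak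 f$). In particular, $(o^-)^\top$ is canonically identified with $V^+=e^{\mathrm{ad}(\mathfrak g_1)}.o^+$. (4) Let $\Omega^+=\{g\in G: g.o^+\in V^+\}$. Then the map $$\mathfrak g_1\times H\times\mathfrak g_{-1}\to\Omega^+,\qquad (v,h,w)\mapsto e^{\mathrm{ad}(v)}\,h\,e^{\mathrm{ad}(w)}$$ is a bijection, and moreover $\Omega^+=\{g\in G: d_g(o^+)\in\mathrm{GL}(\mathfrak g_1),\ c_g(o^+)\in\mathrm{GL}(\mathfrak g_{-1})\}$. (5) The spaces $X^\pm\subset\mathcal F$ and $M\subset\mathcal G$ are stable under the action of the automorphism group $\mathrm{Aut}(\mathfrak g,D)$ and of the extended projective elementary group $G^{\rm ext}$.
   Context: $\mathbb K$ is a commutative ring with unit in which $2$ and $3$ are invertible; $\mathfrak g$ is a Lie algebra over $\mathbb K$ with center $\mathfrak z(\mathfrak g)$. An Euler operator is $E\in\mathfrak g$ with $\mathrm{ad}(E)^3=\mathrm{ad}(E)$; $\mathcal G=\{\mathrm{ad}(E): E\text{ an Euler operator}\}$. For $D\in\mathcal G$ let $\mathfrak g_i=\{X:DX=iX\}$ ($i=1,0,-1$), so that $\mathfrak g=\mathfrak g_1\oplus\mathfrak g_0\oplus\mathfrak g_{-1}$ with $[\mathfrak g_k,\mathfrak g_l]\subset\mathfrak g_{k+l}$. A $3$-filtration is a flag of submodules $0=\mathfrak f_2\subset\mathfrak f_1\subset\mathfrak f_0\subset\mathfrak f_{-1}=\mathfrak g$, written $(\mathfrak f_1,\mathfrak f_0)$,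 with $[\mathfrak f_k,\mathfrak f_l]\subset\mathfrak f_{k+l}$. Put $\mathfrak f^+(D)=(\mathfrak g_1,\mathfrak g_0\oplus\mathfrak g_1)$, $\mathfrak f^-(D)=(\mathfrak g_{-1},\mathfrak g_0\oplus\mathfrak g_{-1})$, and $\mathcal F=\{\mathfrak f^+(D):D\in\mathcal G\}$ (inner $3$-filtrations). Flags $\mathfrak e,\mathfrak f$ are transversal, $\mathfrak e\top\mathfrak f$, if $\mathfrak g=\mathfrak e_1\oplus\mathfrak f_0=\mathfrak f_1\oplus\mathfrak e_0$; $\mathfrak e^\top=\{\mathfrak f\in\mathcal F:\mathfrak f\top\mathfrak e\}$. The group $\mathrm{Aut}(\mathfrak g)$ acts on $\mathcal F$ by $g.(\mathfrak f_1,\mathfrak f_0)=(g\mathfrak f_1,g\mathfrak f_0)$ and on $\mathcal G$ by conjugation. An element $D\in\mathcal G$ is identified with the transversal pair formed by its two filtrations $\mathfrak f^\pm(D)$; every transversal pair in $\mathcal F\times\mathcal F$ arises this way. Fix $D=\mathrm{ad}(E)\in\mathcal G$. For $x\in\mathfrak g_{\pm1}$, $e^{\mathrm{ad}\,x}=1+\mathrm{ad}\,x+\frac12(\mathrm{ad}\,x)^2\in\mathrm{Aut}(\mathfrak g)$. The projective elementary group $G\subset\mathrm{Aut}(\mathfrak g)$ is generated by all $e^{\mathrm{ad}\,x}$, $x\in\mathfrak g_{1}\cup\mathfrak g_{-1}$. Put $U^\pm=e^{\mathrm{ad}(\mathfrak g_{\pm1})}$, $\mathrm{Aut}(\mathfrak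 g,D)=\{g\in\mathrm{Aut}(\mathfrak g):gD=Dg\}$, $H=G\cap\mathrm{Aut}(\mathfrak g,D)$, $P^\pm=HU^\pm=U^\pm H$ (subgroups of $G$), $X^\pm=G/P^\mp$, $M=G/H$. The base points are $o^+=\mathfrak f^-$, $o^-=\mathfrak f^+$, and $V^+=e^{\mathrm{ad}(\mathfrak g_1)}.o^+\subset\mathcal F$. For $r\in\mathbb K^\times$ let $h^{(D,r)}\in\mathrm{Aut}(\mathfrak g)$ act as $r$ on $\mathfrak g_1$, $1$ on $\mathfrak g_0$, $r^{-1}$ on $\mathfrak g_{-1}$; $G^{\rm ext}$ is the group generated by $G$ and all $h^{(D,r)}$, $r\in\mathbb K^\times$. For $g\in\mathrm{Aut}(\mathfrak g)$ let $g_{ij}=\mathrm{pr}_i\circ g\circ\iota_j:\mathfrak g_j\to\mathfrak g_i$, with inclusions $\iota_j$ and projections $\mathrm{pr}_i$ of the grading. For $x\in\mathfrak g_1$ put $d_g(x)=(e^{-\mathrm{ad}(x)}g^{-1})_{11}\in\mathrm{End}(\mathfrak g_1)$, $c_g(x)=(g\,e^{\mathrm{ad}(x)})_{-1,-1}\in\mathrm{End}(\mathfrak g_{-1})$. The point $o^+$ corresponds to $x=0$, so $d_g(o^+)=(g^{-1})_{11}$ and $c_g(o^+)=g_{-1,-1}$. *)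

(* Defs.v *)
From HB Require Import structures.
From mathcomp Require Import all_boot all_order all_algebra.
From mathcomp Require Import mathcomp_extra boolp classical_sets functions.

Set Implicit Arguments.
Unset Strict Implicit.
Unset Printing Implicit Defensive.

Import GRing.Theory.
Local Open Scope classical_set_scope.
Local Open Scope ring_scope.

HB.mixin Record isLieAlgebra (K : comNzRingType) L of GRing.Lmodule K L := {
  lie : L -> L -> L;
  lieDl : forall x y z, lie (x + y) z = lie x z + lie y z;
  lieZl : forall a x y, lie (a *: x) y = a *: lie x y;
  lieDr : forall x y z, lie x (y + z) = lie x y + lie x z;
  lieZr : forall a x y, lie x (a *: y) = a *: lie x y;
  liexx : forall x, lie x x = 0;
  lie_jacobi : forall x y z,
    lie x (lie y z) + lie y (lie z x) + lie z (lie x y) = 0 }.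

#[short(type="lieAlgType")]
HB.structure Definition LieAlgebra (K : comNzRingType) :=
  { L of isLieAlgebra K L & GRing.Lmodule K L }.

(* Submodules of a module L are represented by subsets [set L], and operators
   on L by plain functions [L -> L]; group multiplication is composition. *)

Section Modules.
Context {K : comUnitRingType} {L : lmodType K}.
Implicit Types (V A B : set L) (f : L -> L).

Definition is_submodule V : Prop :=
  V 0 /\ forall (a : K) x y, V x -> V y -> V (a *: x + y).

Definition msum A B : set L := [set x + y | x in A & y in B].

Definition direct_decomp A B : Prop :=
  msum A B = [set: L] /\ A `&` B = [set 0].

Definition linear_on V f : Prop :=
  forall (a : K) x y, V x -> V y -> f (a *: x + y) = a *: f x + f y.

(* Endomorphisms of the submodule V are given by functions on L, of which only
   the restriction to V matters. *)
Definition GL V : set (L -> L) := [set f | linear_on V f /\ set_bij V V f].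

Definition module_iso V A : Prop :=
  exists phi : L -> L, linear_on V phi /\ set_bij V A phi.

(* S is an affine space with translation group the additive group of V. *)
Definition affine_space (T : Type) V (S : set T) (act : L -> T -> T) : Prop :=
  is_submodule V /\ S !=set0 /\
  (forall x s, V x -> S s -> S (act x s)) /\
  (forall s, S s -> act 0 s = s) /\
  (forall x y s, V x -> V y -> S s -> act (x + y) s = act x (act y s)) /\
  (forall s t, S s -> S t -> exists! x, V x /\ act x s = t).

(* A flag 0 = f_2 <= f_1 <= f_0 <= f_{-1} = L is recorded as (f_1, f_0). *)
Definition flag : Type := (set L * set L)%type.

Definition transversal (e f : flag) : Prop :=
  direct_decomp e.1 f.2 /\ direct_decomp f.1 e.2.

Definition flag_act (g : L -> L) (f : flag) : flag := (g @` f.1, g @` f.2).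

Definition flag_pair_act (g : L -> L) (p : flag * flag) : flag * flag :=
  (flag_act g p.1, flag_act g p.2).

(* Used only for bijective g, where it is the inverse (see [inv_mapK]). *)
Definition inv_map (g : L -> L) : L -> L := 'pinv_(fun=> 0) [set: L] g.

Definition conj_act (g D : L -> L) : L -> L := g \o D \o inv_map g.

Definition orbit_of (T : Type) (G : set (L -> L)) (act : (L -> L) -> T -> T)
  (t : T) : set T := [set act g t | g in G].

Definition lcoset_of (P : set (L -> L)) (g : L -> L) : set (L -> L) :=
  [set g \o p | p in P].

Definition quotient_by (G P : set (L -> L)) : set (set (L -> L)) :=
  [set lcoset_of P g | g in G].

(* G/P and the G-orbit of t are isomorphic as pointed G-spaces: the unique
   candidate g P |-> g.t is well defined and bijective. *)
Definition homogeneous_iso (T : Type) (G P : set (L -> L))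
    (act : (L -> L) -> T -> T) (t : T) : Prop :=
  exists phi : set (L -> L) -> T,
    set_bij (quotient_by G P) (orbit_of G act t) phi /\
    forall g, G g -> phi (lcoset_of P g) = act g t.

Definition stable_under (T : Type) (S : set (L -> L))
    (act : (L -> L) -> T -> T) (X : set T) : Prop :=
  forall g t, S g -> X t -> X (act g t).

(* For an operator D and i = 1, 0, -1. *)
Definition gr (D : L -> L) (i : int) : set L := [set x | D x = x *~ i].

(* fil D 1 = f^+(D) and fil D (-1) = f^-(D). *)
Definition fil (D : L -> L) (s : int) : flag :=
  (gr D s, msum (gr D 0) (gr D s)).

(* If D^3 = D and 2 is invertible, then pr D i, for i = 1, 0, -1, is the
   projection onto gr D i along the other two summands (see [pr_in], [pr_id],
   [pr_eq0] and [pr_sum]): pr_0 = 1 - D^2 and pr_{+-1} = (D^2 +- D) / 2. *)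
Definition pr (D : L -> L) (i : int) (x : L) : L :=
  if i == 0 then x - D (D x) else 2%:R^-1 *: (D (D x) + D x *~ i).

(* The component g_ij, extended by zero to the summands other than gr D j. *)
Definition component (D : L -> L) (i j : int) (g : L -> L) : L -> L :=
  pr D i \o g \o pr D j.

End Modules.
Arguments flag {K} L.

Section LieAlgebras.
Context {K : comUnitRingType} {L : lieAlgType K}.
Implicit Types (D g : L -> L) (s : int).

Definition ad (x : L) : L -> L := lie x.

Definition center : set L := [set z | forall x, lie z x = 0].

Definition euler_operator (E : L) : Prop := ad E \o ad E \o ad E = ad E.

Definition euler_derivations : set (L -> L) :=
  [set ad E | E in euler_operator].

Definition inner_filtrations : set (flag L) :=
  [set fil D 1 | D in euler_derivations].

Definition transversals (e : flag L) : set (flag L) :=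
  [set f | inner_filtrations f /\ transversal f e].

Definition transversal_pairs : set (flag L * flag L) :=
  [set p | inner_filtrations p.1 /\ inner_filtrations p.2 /\
           transversal p.1 p.2].

(* The identification of D with its transversal pair, the base point of
   X^+ coming first. *)
Definition pair_of D : flag L * flag L := (fil D (-1), fil D 1).

Definition Aut : set (L -> L) :=
  [set g | [/\ linear g, bijective g & {morph g : x y / lie x y}]].

Definition Aut_subgroup (S : set (L -> L)) : Prop :=
  [/\ S `<=` Aut, S id,
      forall g h, S g -> S h -> S (g \o h) &
      forall g, S g -> S (inv_map g)].

(* The full exponential series whenever (ad x)^3 = 0, in particular for x in
   e_1, e an inner filtration. *)
Definition exp_ad (x y : L) : L :=
  y + ad x y + 2%:R^-1 *: ad x (ad x y).

Definition elementary_group D : set (L -> L) :=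
  smallest Aut_subgroup [set exp_ad x | x in gr D 1 `|` gr D (-1)].

Definition U D s : set (L -> L) := [set exp_ad x | x in gr D s].

Definition Aut_gr D : set (L -> L) := [set g | Aut g /\ g \o D = D \o g].

Definition H D : set (L -> L) := elementary_group D `&` Aut_gr D.

Definition P D s : set (L -> L) := [set h \o u | h in H D & u in U D s].

(* X D 1 and X D (-1) are X^+ and X^-, as subsets of the space of inner
   filtrations; the base point of X^{+-} is f^{-+}. *)
Definition X D s : set (flag L) :=
  orbit_of (elementary_group D) flag_act (fil D (- s)).

Definition M D : set (L -> L) := orbit_of (elementary_group D) conj_act D.

Definition Vplus D : set (flag L) :=
  [set flag_act (exp_ad x) (fil D (-1)) | x in gr D 1].

Definition Omega_plus D : set (L -> L) :=
  [set g | elementary_group D g /\ Vplus D (flag_act g (fil D (-1)))].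

Definition h_scale D (r : K) (x : L) : L :=
  r *: pr D 1 x + pr D 0 x + r^-1 *: pr D (-1) x.

Definition ext_elementary_group D : set (L -> L) :=
  smallest Aut_subgroup
    (elementary_group D `|` [set h_scale D r | r in [set r | r \is a GRing.unit]]).

Definition denom D g (x : L) : L -> L :=
  component D 1 1 (exp_ad (- x) \o inv_map g).

Definition codenom D g (x : L) : L -> L :=
  component D (-1) (-1) (g \o exp_ad x).

End LieAlgebras.
Arguments center {K} L.
Arguments euler_derivations {K} L.
Arguments inner_filtrations {K} L.
Arguments transversal_pairs {K} L.
Arguments Aut {K} L.

Section Projections.
Context {K : comUnitRingType} {L : lieAlgType K}.
Context (two_unit : (2%:R : K) \is a GRing.unit).
Context (E : L) (eulerE : euler_operator E).
Let D := ad E.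

Let D3 x : D (D (D x)) = D x.
Proof. by move/(congr1 (fun f => f x)): eulerE. Qed.

Let DD x y : D (x + y) = D x + D y. Proof. exact: lieDr. Qed.
Let DZ a x : D (a *: x) = a *: D x. Proof. exact: lieZr. Qed.
Let DN x : D (- x) = - D x.
Proof. by rewrite -scaleN1r DZ scaleN1r. Qed.
Let D0 : D 0 = 0.
Proof. by have := DZ 0 0; rewrite !scale0r. Qed.

Let half2 (x : L) : 2%:R^-1 *: (x + x) = x.
Proof. by rewrite -mulr2n -scaler_nat scalerA mulVr // scale1r. Qed.

Lemma pr_in (i : int) x : i \in [:: 1; 0; -1] -> gr D i (pr D i x).
Proof.
rewrite !inE => /or3P[] /eqP->; rewrite /gr /pr /=.
- by rewrite !mulr1z DZ DD !D3 [X in _ *: X]addrC.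
- by rewrite DD DN D3 subrr mulr0z.
- by rewrite !mulrNz !mulr1z DZ DD DN !D3 -scalerN opprB.
Qed.

Lemma pr_sum x : x = pr D 1 x + pr D 0 x + pr D (-1) x.
Proof.
rewrite /pr /= mulrNz !mulr1z addrAC -scalerDr addrACA subrr addr0 half2.
by rewrite addrC subrK.
Qed.

Lemma pr_id (i : int) x : i \in [:: 1; 0; -1] -> gr D i x -> pr D i x = x.
Proof.
rewrite !inE => /or3P[] /eqP->; rewrite /gr /pr /= ?mulrNz ?mulr1z ?mulr0z => h.
- by rewrite !h half2.
- by rewrite h D0 subr0.
- by rewrite h DN h !opprK half2.
Qed.

Lemma pr_eq0 (i j : int) x : i \in [:: 1; 0; -1] -> j \in [:: 1; 0; -1] ->
  i != j -> gr D j x -> pr D i x = 0.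
Proof.
rewrite !inE => /or3P[] /eqP-> /or3P[] /eqP-> //= _;
  rewrite /gr /pr /= ?mulrNz ?mulr1z ?mulr0z => h;
  by rewrite ?(h, DN, D0, opprK, oppr0, addr0, subrr, addNr, scaler0).
Qed.

Lemma inv_mapK (g : L -> L) : bijective g ->
  cancel g (inv_map g) /\ cancel (inv_map g) g.
Proof.
move=> [f fK gK]; have inj : {in [set: L] &, injective g}.
  by move=> x y _ _ /(congr1 f); rewrite !fK.
have K1 : cancel g (inv_map g).
  by move=> x; exact: (@pinvKV _ _ (fun=> 0) _ _ inj _ (in_setT x)).
by split=> // x; rewrite -[x]gK K1.
Qed.

End Projections.

(* Main.v *)
Require Import Defs.
From HB Require Import structures.
From mathcomp Require Import all_boot all_order all_algebra.
From mathcomp Require Import mathcomp_extra boolp classical_sets functions.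

Set Implicit Arguments.
Unset Strict Implicit.
Unset Printing Implicit Defensive.

Import GRing.Theory.
Local Open Scope classical_set_scope.
Local Open Scope ring_scope.
Local Notation transversal := Defs.transversal.

(** The proof works with Euler operators rather than with flags: an automorphism
    g carries the grading of ad E to that of ad (g E), so the G-orbits of D and
    of its two filtrations are governed by where g sends E.  For x in gr D s the
    exponential fixes fil D s and sends E to E - s x.

    The heart of the matter is [transversal_exp]: an inner filtration e
    transversal to fil D s is the translate of the opposite filtration fil D (- s)
    by the exponential of some x in gr D s, and x is unique ([exp_fil_inj]).  To
    find x, split E along gr D s and the larger module of e.  The
    second component is the translate E' of E by the exponential of s times the
    first; it defines the same fil D s, and its adjoint action preserves e, so
    e is graded for E' and transversality forces it to be the filtration opposite
    to fil D s.

    Thus the exponentials of gr D s act simply transitively on the filtrations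
    transversal to fil D s.  This gives the affine charts, the description of
    transversal pairs in an orbit, and the factorization of the stabilizer of
    fil D s ([P_stab]): after composition with an exponential an element of the
    stabilizer also fixes fil D (- s), hence commutes with D.  The big cell is the
    product of the chart with such a stabilizer ([big_cell]), and the condition on
    denominators rewrites transversality as the bijectivity of two projections
    ([decomp_component]).  Stability under further automorphisms holds because
    those commuting with D normalize G and fix the base points. *)

(** * Brackets and automorphisms *)

Section Brackets.
Context {K : comUnitRingType} {L : lieAlgType K}.
Implicit Types (x y z : L) (g h : L -> L).

Lemma lie0r x : lie x 0 = 0.
Proof. by have := lieZr 0 x (0 : L); rewrite !scale0r. Qed.

Lemma lie0l x : lie 0 x = 0.
Proof. by have := lieZl 0 (0 : L) x; rewrite !scale0r. Qed.

Lemma lieNr x y : lie x (- y) = - lie x y.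
Proof. by rewrite -scaleN1r lieZr scaleN1r. Qed.

Lemma lieNl x y : lie (- x) y = - lie x y.
Proof. by rewrite -scaleN1r lieZl scaleN1r. Qed.

Lemma lieC x y : lie x y = - lie y x.
Proof.
apply/eqP; rewrite -addr_eq0; have := liexx (x + y).
by rewrite lieDl !lieDr !liexx add0r addr0 => ->.
Qed.

Lemma lie_derivation x y z :
  lie x (lie y z) = lie (lie x y) z + lie y (lie x z).
Proof.
have := lie_jacobi x y z; rewrite (lieC z x) lieNr (lieC z (lie x y)) => /eqP.
by rewrite -addrA -opprD subr_eq0 => /eqP ->; rewrite addrC.
Qed.

Lemma ad_inj_center x y : ad x = ad y <-> center L (x - y).
Proof.
split=> [xy z|xy]; first by rewrite lieDl lieNl; move: (congr1 (@^~ z) xy);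
  rewrite /ad => ->; rewrite subrr.
by apply/funext => z; apply/eqP; rewrite -subr_eq0 /ad -lieNl -lieDl xy.
Qed.

Section OneAutomorphism.
Context (g : L -> L) (gA : Aut L g).

Lemma autD x y : g (x + y) = g x + g y.
Proof. by case: gA => l _ _; have := l 1 x y; rewrite !scale1r. Qed.

Lemma aut0 : g 0 = 0.
Proof. by have := autD 0 0; rewrite addr0 => /esym/eqP; rewrite -subr_eq0 addrK => /eqP. Qed.

Lemma autZ a x : g (a *: x) = a *: g x.
Proof. by case: gA => l _ _; have := l a x 0; rewrite !addr0 aut0 addr0. Qed.

Lemma autN x : g (- x) = - g x.
Proof. by rewrite -scaleN1r autZ scaleN1r. Qed.

Lemma autB x y : g (x - y) = g x - g y.
Proof. by rewrite autD autN. Qed.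

Lemma autMz x (i : int) : g (x *~ i) = g x *~ i.
Proof. by rewrite -!scaler_int autZ. Qed.

Lemma aut_lie x y : g (lie x y) = lie (g x) (g y).
Proof. by case: gA. Qed.

Lemma autK : cancel g (inv_map g).
Proof. by case: gA => _ /inv_mapK[]. Qed.

Lemma autVK : cancel (inv_map g) g.
Proof. by case: gA => _ /inv_mapK[]. Qed.

Lemma aut_inj : injective g.
Proof. exact: can_inj autK. Qed.

Lemma autVo : inv_map g \o g = id.
Proof. by apply/funext => x /=; rewrite autK. Qed.

Lemma autoV : g \o inv_map g = id.
Proof. by apply/funext => x /=; rewrite autVK. Qed.

Lemma aut_inv : Aut L (inv_map g).
Proof.
split; last by move=> x y; apply: aut_inj; rewrite aut_lie !autVK.
- by move=> a x y; apply: aut_inj; rewrite autD autZ !autVK.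
- by exists g; [exact: autVK|exact: autK].
Qed.

End OneAutomorphism.

Lemma aut_id : Aut L id.
Proof. by split=> //; exists id. Qed.

Lemma aut_comp g h : Aut L g -> Aut L h -> Aut L (g \o h).
Proof.
move=> gA hA; split=> [a x y| |x y] /=.
- by rewrite !autD // !autZ.
- by apply: bij_comp; [case: gA|case: hA].
- by rewrite !aut_lie.
Qed.

Lemma Aut_is_subgroup : Aut_subgroup (Aut L).
Proof. by split=> //; [exact: aut_id|exact: aut_comp|exact: aut_inv]. Qed.

(** An automorphism is bijective, so a right inverse is its inverse. *)
Lemma inv_map_uniq g h : Aut L g -> g \o h = id -> inv_map g = h.
Proof.
move=> gA gh; apply/funext => x; apply: (aut_inj gA); rewrite autVK //.
by have := congr1 (@^~ x) gh.
Qed.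

Lemma inv_mapI g : Aut L g -> inv_map (inv_map g) = g.
Proof. by move=> gA; apply: inv_map_uniq; [exact: aut_inv|exact: autVo]. Qed.

Lemma inv_map_id : inv_map (@id L) = id.
Proof. by apply: inv_map_uniq => //; exact: aut_id. Qed.

Lemma inv_map_comp g h : Aut L g -> Aut L h ->
  inv_map (g \o h) = inv_map h \o inv_map g.
Proof.
move=> gA hA; apply: inv_map_uniq; first exact: aut_comp.
by apply/funext => x /=; rewrite !autVK.
Qed.

(** ** The actions on flags and on inner derivations *)

Lemma flag_act_id (e : flag L) : flag_act id e = e.
Proof. by case: e => a b; rewrite /flag_act /= !image_id. Qed.

Lemma flag_act_comp g h (e : flag L) :
  flag_act (g \o h) e = flag_act g (flag_act h e).
Proof. by rewrite /flag_act /= !image_comp. Qed.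

Lemma flag_actK g (e : flag L) : Aut L g ->
  flag_act (inv_map g) (flag_act g e) = e.
Proof. by move=> gA; rewrite -flag_act_comp autVo // flag_act_id. Qed.

Lemma flag_actVK g (e : flag L) : Aut L g ->
  flag_act g (flag_act (inv_map g) e) = e.
Proof. by move=> gA; rewrite -flag_act_comp autoV // flag_act_id. Qed.

Lemma conj_act_id D : conj_act id D = D :> (L -> L).
Proof. by rewrite /conj_act inv_map_id. Qed.

Lemma conj_act_comp g h D : Aut L g -> Aut L h ->
  conj_act (g \o h) D = conj_act g (conj_act h D).
Proof. by move=> gA hA; rewrite /conj_act inv_map_comp. Qed.

Lemma conj_ad g x : Aut L g -> conj_act g (ad x) = ad (g x).
Proof. by move=> gA; apply/funext => y; rewrite /conj_act /= /ad aut_lie // autVK. Qed.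

Lemma conj_act_fixed g D : Aut L g -> conj_act g D = D <-> g \o D = D \o g.
Proof.
move=> gA; split=> [gD|gD].
  by rewrite -{2}gD /conj_act -[RHS]compA autVo.
by rewrite /conj_act gD -compA autoV.
Qed.

Lemma gr_aut g x i : Aut L g -> gr (ad (g x)) i = g @` gr (ad x) i.
Proof.
move=> gA; rewrite eqEsubset; split=> y /=; last first.
  by move=> [z zi <-]; rewrite /gr /= /ad -aut_lie // -autMz // [lie x z]zi.
move=> yi; exists (inv_map g y); last exact: autVK.
by apply: (aut_inj gA); rewrite autMz // aut_lie // autVK.
Qed.

Lemma msum_aut g (A B : set L) : Aut L g ->
  g @` msum A B = msum (g @` A) (g @` B).
Proof.
move=> gA; rewrite eqEsubset; split=> y.
  move=> [_ [a Aa [b Bb <-]] <-]; exists (g a); first by exists a.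
  by exists (g b); [exists b|rewrite autD].
move=> [_ [a Aa <-] [_ [b Bb <-] <-]]; exists (a + b); last exact: autD.
by exists a => //; exists b.
Qed.

Lemma fil_aut g x s : Aut L g -> fil (ad (g x)) s = flag_act g (fil (ad x) s).
Proof. by move=> gA; rewrite /fil /flag_act /= msum_aut // !gr_aut. Qed.

Lemma euler_aut g x : Aut L g -> euler_operator x -> euler_operator (g x).
Proof.
move=> gA ex; apply/funext => y; rewrite /= /ad -[y](autVK gA) -!aut_lie //.
by congr (g _); have := congr1 (@^~ (inv_map g y)) ex.
Qed.

Lemma inner_aut g e : Aut L g -> inner_filtrations L e ->
  inner_filtrations L (flag_act g e).
Proof.
move=> gA [_ [x ex <-] <-]; exists (ad (g x)); last exact: fil_aut.
by exists (g x) => //; exact: euler_aut.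
Qed.

Lemma direct_decomp_aut g (A B : set L) : Aut L g ->
  direct_decomp A B -> direct_decomp (g @` A) (g @` B).
Proof.
move=> gA [sAB iAB]; split.
  rewrite -msum_aut // sAB; apply/seteqP; split=> // x _.
  by exists (inv_map g x) => //; exact: autVK.
apply/seteqP; split=> [_ [[a Aa <-] [b Bb /(aut_inj gA) ba]]|_ ->]; last first.
  have [A0 B0] : (A `&` B) 0 by rewrite iAB.
  by split; exists 0 => //; exact: aut0.
have : (A `&` B) a by split=> //; rewrite -ba.
by rewrite iAB => ->; rewrite /= aut0.
Qed.

Lemma transversal_aut g e f : Aut L g -> transversal e f ->
  transversal (flag_act g e) (flag_act g f).
Proof. by move=> gA [ef fe]; split; exact: direct_decomp_aut. Qed.

(** ** Subgroups of the automorphism group *)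

Lemma smallest_subgroup (S : set (L -> L)) : S `<=` Aut L ->
  Aut_subgroup (smallest Aut_subgroup S).
Proof.
move=> SA; split.
- by move=> g /(_ (Aut L)); apply; split=> //; exact: Aut_is_subgroup.
- by move=> A [[]].
- by move=> g h Sg Sh A AS; have [[_ _ c _] _] := AS; apply: c; [exact: Sg|exact: Sh].
- by move=> g Sg A AS; have [[_ _ _ c] _] := AS; apply: c; exact: Sg.
Qed.

Definition is_action (T : Type) (act : (L -> L) -> T -> T) : Prop :=
  (forall t, act id t = t) /\
  (forall g h t, Aut L g -> Aut L h -> act (g \o h) t = act g (act h t)).

Lemma flag_action : is_action (@flag_act K L).
Proof. by split=> [t|g h t _ _]; [exact: flag_act_id|exact: flag_act_comp]. Qed.

Lemma conj_action : is_action (@conj_act K L).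
Proof. by split=> [t|g h t gA hA]; [exact: conj_act_id|exact: conj_act_comp]. Qed.

(** A coset is sent to the value at t of an arbitrary representative. *)
Lemma orbit_stabilizer T (act : (L -> L) -> T -> T) (G Q : set (L -> L)) t :
  is_action act -> Aut_subgroup G -> Q = [set g | G g /\ act g t = t] ->
  homogeneous_iso G Q act t.
Proof.
move=> [act1 actM] [GA G1 GM GV] ->; set Q' := [set _ | _].
pose phi (C : set (L -> L)) :=
  if pselect (exists g, C g) is left C0 then act (sval (cid C0)) t else t.
have phiE g : G g -> phi (lcoset_of Q' g) = act g t.
  move=> Gg; rewrite /phi; case: pselect => [C0|[]]; last first.
    by exists g, id => //; split.
  by case: cid => _ /= [p [Gp pt] <-]; rewrite actM ?pt //; exact: GA.
exists phi; split=> //; split.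
- by move=> _ [g Gg <-]; exists g; rewrite ?phiE.
- move=> _ _ /set_mem[g Gg <-] /set_mem[h Gh <-]; rewrite !phiE // => gh.
  (* g^-1 h fixes t, so that the cosets of g and of h coincide. *)
  have sub a b : G a -> G b -> act a t = act b t ->
      lcoset_of Q' b `<=` lcoset_of Q' a.
    move=> Ga Gb ab _ [p [Gp pt] <-]; have Aa := GA a Ga; have Ab := GA b Gb; have Ap := GA p Gp.
    have AV := aut_inv Aa; exists (inv_map a \o (b \o p)).
      split; first by apply: (GM _ _ (GV _ Ga)); exact: GM.
      rewrite (actM _ _ _ AV (aut_comp Ab Ap)) (actM _ _ _ Ab Ap) pt -ab.
      by rewrite -(actM _ _ _ AV Aa) autVo.
    by rewrite compA (autoV Aa).
  by apply/seteqP; split; exact: sub.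
- by move=> _ [g Gg <-]; exists (lcoset_of Q' g); [exists g|exact: phiE].
Qed.

(** The elements of a group that map Y into itself need not form a group; those
   that do so together with their inverses do. *)
Lemma stable_smallest T (act : (L -> L) -> T -> T) (S : set (L -> L)) (Y : set T) :
  is_action act -> S `<=` Aut L ->
  (forall g t, S g -> Y t -> Y (act g t) /\ Y (act (inv_map g) t)) ->
  stable_under (smallest Aut_subgroup S) act Y.
Proof.
move=> [act1 actM] SA SY g t Sg.
pose N : set (L -> L) :=
  [set h | Aut L h /\ forall t, Y t -> Y (act h t) /\ Y (act (inv_map h) t)].
suff [_ NY] : N g by move=> /NY[].
apply: Sg; split; last by move=> h Sh; split; [exact: SA|move=> u; exact: SY].
split=> [h []// | | h k [hA hY] [kA kY] | h [hA hY]].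
- by split; [exact: aut_id|move=> u Yu; rewrite inv_map_id act1].
- split; first exact: aut_comp.
  move=> u Yu; rewrite inv_map_comp // (actM _ _ _ hA kA).
  rewrite (actM _ _ _ (aut_inv kA) (aut_inv hA)).
  by split; [apply: (hY _ _).1; exact: (kY _ _).1|apply: (kY _ _).2; exact: (hY _ _).2].
- split; first exact: aut_inv.
  by move=> u Yu; rewrite inv_mapI //; have [] := hY u Yu.
Qed.

End Brackets.

(** * Gradings defined by Euler operators *)

Definition sign (s : int) : Prop := s = 1 \/ s = -1.

Lemma sign_opp s : sign s -> sign (- s).
Proof. by case=> ->; [right|left]. Qed.

Section Submodules.
Context {K : comUnitRingType} {L : lmodType K} {V : set L}.
Context (VP : is_submodule V).

Lemma submod0 : V 0. Proof. by case: VP. Qed.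

Lemma submodD x y : V x -> V y -> V (x + y).
Proof. by move=> Vx Vy; rewrite -[x]scale1r; apply: VP.2. Qed.

Lemma submodZ a x : V x -> V (a *: x).
Proof. by move=> Vx; rewrite -[_ *: _]addr0; apply: VP.2 => //; exact: submod0. Qed.

Lemma submodMz x (i : int) : V x -> V (x *~ i).
Proof. by rewrite -scaler_int; exact: submodZ. Qed.

Lemma submodN x : V x -> V (- x).
Proof. by rewrite -scaleN1r; exact: submodZ. Qed.

Lemma submodB x y : V x -> V y -> V (x - y).
Proof. by move=> Vx Vy; apply: submodD => //; exact: submodN. Qed.

Lemma submod_msum (W : set L) : is_submodule W -> is_submodule (msum V W).
Proof.
move=> WP; split; first by exists 0; [exact: submod0|exists 0; [exact: WP.1|rewrite addr0]].
move=> a _ _ [v Vv [w Ww <-]] [v' Vv' [w' Ww' <-]].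
exists (a *: v + v'); first exact: VP.2.
by exists (a *: w + w'); [exact: WP.2|rewrite scalerDr addrACA].
Qed.

End Submodules.

Section Homogeneous.
Context {K : comUnitRingType} {L : lieAlgType K}.
Implicit Types (E x y : L) (i j s : int).

Lemma gr_submodule E i : is_submodule (gr (ad E) i).
Proof.
split; first by rewrite /gr /= /ad lie0r mul0rz.
by move=> a x y; rewrite /gr /= /ad lieDr lieZr => -> ->; rewrite mulrzDl -scalerMzr.
Qed.

Lemma fil_submodule E s : is_submodule (fil (ad E) s).2.
Proof. by apply: submod_msum; exact: gr_submodule. Qed.

Lemma lie_gr E i j x y : gr (ad E) i x -> gr (ad E) j y ->
  gr (ad E) (i + j) (lie x y).
Proof.
rewrite /gr /= /ad => xi yj; rewrite lie_derivation xi yj.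
by rewrite -scaler_int lieZl -(scaler_int j) lieZr !scaler_int mulrzDr.
Qed.

(** Replacing E by -E exchanges the two filtrations; this is why both are inner. *)
Lemma gr_opp E i : gr (ad (- E)) i = gr (ad E) (- i).
Proof.
apply/seteqP; split=> x; rewrite /gr /= /ad lieNl mulrNz.
  by move/(congr1 -%R); rewrite opprK.
by move=> ->; rewrite opprK.
Qed.

Lemma fil_opp E s : fil (ad (- E)) s = fil (ad E) (- s).
Proof. by rewrite /fil !gr_opp oppr0. Qed.

Lemma euler_opp E : euler_operator E -> euler_operator (- E).
Proof.
move=> eE; apply/funext => x; rewrite /= /ad !lieNl !lieNr opprK.
by have /= := congr1 (@^~ x) eE; rewrite /ad => ->.
Qed.

Lemma sub_fil E s x : gr (ad E) s x -> (fil (ad E) s).2 x.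
Proof. by move=> xs; exists 0; [exact: (gr_submodule _ _).1|exists x => //; rewrite add0r]. Qed.

Lemma gr0_fil E s x : gr (ad E) 0 x -> (fil (ad E) s).2 x.
Proof. by move=> x0; exists x => //; exists 0; [exact: (gr_submodule _ _).1|rewrite addr0]. Qed.

Lemma euler_gr0 E : gr (ad E) 0 E.
Proof. by rewrite /gr /= /ad liexx mulr0z. Qed.

Lemma prD (D : L -> L) i x y : {morph D : u v / u + v} ->
  pr D i (x + y) = pr D i x + pr D i y.
Proof.
move=> DD; rewrite /pr; case: eqP => _; rewrite !DD.
  by rewrite opprD addrACA.
by rewrite mulrzDl addrACA scalerDr.
Qed.

Lemma linear_component E i j g : Aut L g ->
  linear_on [set: L] (component (ad E) i j g).
Proof.
have prZ k a x : pr (ad E) k (a *: x) = a *: pr (ad E) k x.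
  rewrite /pr /ad !lieZr; case: eqP => _; first by rewrite -scalerN -scalerDr.
  by rewrite scalerA mulrC scalerMzr -scalerDr scalerA.
have prDE k x y : pr (ad E) k (x + y) = pr (ad E) k x + pr (ad E) k y.
  by apply: prD => u v; exact: lieDr.
by move=> gA a x y _ _; rewrite /component /= prDE prZ (autD gA) (autZ gA) prDE prZ.
Qed.

End Homogeneous.

Section Grading.
Context {K : comUnitRingType} {L : lieAlgType K}.
Context (two_unit : (2%:R : K) \is a GRing.unit).
Context (three_unit : (3%:R : K) \is a GRing.unit).
Implicit Types (E x y : L) (i j s : int).

(** On degree s + s = 2 s the identity D ^ 3 = D reads 8 s = 2 s, so elements of
    that degree are killed by 6. *)
Lemma gr_double E s x : euler_operator E -> sign s -> gr (ad E) (s + s) x -> x = 0.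
Proof.
move=> eE ss; rewrite /gr /= => Dx.
have Dm y k : ad E (y *~ k) = ad E y *~ k by rewrite /ad -!scaler_int lieZr.
have := congr1 (@^~ x) eE; rewrite /= !(Dm, Dx) -!mulrzA => /eqP.
rewrite -subr_eq0 -mulrzBr => /eqP x6.
have : (6%:R : K) *: x = 0.
  rewrite scaler_nat; case: ss x6 => -> x6; first exact: x6.
  by apply: oppr_inj; rewrite oppr0; exact: x6.
have u6 : (6%:R : K) \is a GRing.unit by rewrite (natrM _ 2 3) unitrM two_unit.
by move/(congr1 (fun y => (6%:R : K)^-1 *: y)); rewrite scalerA mulVr // scale1r scaler0.
Qed.

Section OneOperator.
Context (E : L) (eulerE : euler_operator E).
Local Notation D := (ad E).

Let adDr : {morph D : u v / u + v}. Proof. by move=> u v; exact: lieDr. Qed.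

Lemma gr_decomp s x : sign s ->
  exists a b c, [/\ gr D s a, gr D 0 b, gr D (- s) c & x = a + b + c].
Proof.
have P1 := @pr_in _ _ _ eulerE 1 x isT.
have P0 := @pr_in _ _ _ eulerE 0 x isT.
have PN := @pr_in _ _ _ eulerE (-1) x isT.
have xE := pr_sum two_unit E x.
case=> ->; first by exists (pr D 1 x), (pr D 0 x), (pr D (-1) x).
exists (pr D (-1) x), (pr D 0 x), (pr D 1 x); split=> //.
by rewrite [in RHS]addrC [pr D (-1) x + _]addrC addrA -xE.
Qed.

Lemma pr_gr s a b c : sign s -> gr D s a -> gr D 0 b -> gr D (- s) c ->
  [/\ pr D s (a + b + c) = a, pr D 0 (a + b + c) = b & pr D (- s) (a + b + c) = c].
Proof.
move=> ss sa sb sc; rewrite !prD //.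
have id_ i x : i \in [:: 1; 0; -1] -> gr D i x -> pr D i x = x by exact: pr_id.
have eq0 i j x : i \in [:: 1; 0; -1] -> j \in [:: 1; 0; -1] -> i != j ->
   gr D j x -> pr D i x = 0 by exact: pr_eq0.
have z : (0 : int) \in [:: 1; 0; -1] by [].
have [m n] : s \in [:: 1; 0; -1] /\ - s \in [:: 1; 0; -1].
  by case: ss => ->.
have [s0 n0 sn] : [/\ s != 0, - s != 0 & s != - s] by case: ss => ->.
rewrite (id_ _ a m sa) (id_ _ b z sb) (id_ _ c n sc).
rewrite (eq0 _ _ b m z s0 sb) (eq0 _ _ c m n sn sc) (eq0 _ _ c z n _ sc) 1?eq_sym //.
rewrite (eq0 _ _ a z m _ sa) 1?eq_sym // (eq0 _ _ a n m _ sa) 1?eq_sym //.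
by rewrite (eq0 _ _ b n z n0 sb) !addr0 !add0r.
Qed.

Lemma gr_fil_disj s x : sign s -> gr D s x -> (fil D (- s)).2 x -> x = 0.
Proof.
move=> ss xs [b b0 [c cs xE]]; have S := gr_submodule E.
have [p _ _] := pr_gr ss xs (S 0).1 (S (- s)).1.
have [q _ _] := pr_gr ss (S s).1 b0 cs.
by rewrite -p -[RHS]q !addr0 add0r xE.
Qed.

Lemma fil_decomp s : sign s -> direct_decomp (gr D s) (fil D (- s)).2.
Proof.
move=> ss; split; apply/seteqP; split=> // x.
  move=> _; have [a [b [c [sa sb sc ->]]]] := gr_decomp x ss.
  by exists a => //; exists (b + c); [exists b => //; exists c|rewrite addrA].
  by case=> xs xf; exact: gr_fil_disj xf.
by move=> ->; split; [exact: (gr_submodule _ _).1|exact: (fil_submodule _ _).1].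
Qed.

Lemma fil_transversal s : sign s -> transversal (fil D s) (fil D (- s)).
Proof.
move=> ss; split; first exact: fil_decomp.
by rewrite -{2}[s]opprK; apply: fil_decomp; exact: sign_opp.
Qed.

Lemma fil_inner s : sign s -> inner_filtrations L (fil D s).
Proof.
case=> ->; first by exists D => //; exists E.
by rewrite -fil_opp; exists (ad (- E)) => //; exists (- E) => //; exact: euler_opp.
Qed.

End OneOperator.

(** The part of degree 0 is recovered as the intersection of the two larger
    modules of the filtrations. *)
Lemma fil_inj E E' s : sign s -> euler_operator E -> euler_operator E' ->
  fil (ad E) s = fil (ad E') s -> fil (ad E) (- s) = fil (ad E') (- s) ->
  ad E = ad E'.
Proof.
move=> ss eE eE' [s1 s0] [n1 n0]; apply/funext => x.
have [a [b [c [sa sb sc ->]]]] := gr_decomp eE x ss.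
have sa' : gr (ad E') s a by rewrite -s1.
have sc' : gr (ad E') (- s) c by rewrite -n1.
suff sb' : gr (ad E') 0 b.
  by rewrite /ad !lieDr; move: sa sb sc sa' sb' sc'; rewrite /gr /= /ad => -> -> -> -> -> ->.
have : (fil (ad E') s).2 b by rewrite /= -s0; exact: gr0_fil.
have : (fil (ad E') (- s)).2 b by rewrite /= -n0; exact: gr0_fil.
move=> [u u0 [v vs bE]] [u' u0' [v' vs' bE']].
have S := gr_submodule E'.
have [_ _ p] := pr_gr ss (S s).1 u0 vs.
have [_ _ q] := pr_gr ss vs' u0' (S (- s)).1.
move: p q; rewrite add0r addr0 bE [v' + u']addrC bE' => -> v0.
by rewrite -bE v0 addr0.
Qed.

End Grading.

(** * Exponentials *)

Section Exponentials.
Context {K : comUnitRingType} {L : lieAlgType K}.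
Context (two_unit : (2%:R : K) \is a GRing.unit).
Context (three_unit : (3%:R : K) \is a GRing.unit).
Implicit Types (E x y t : L) (s : int).

Lemma exp_ad0 : exp_ad (0 : L) = id.
Proof. by apply/funext => y; rewrite /exp_ad /ad !lie0l scaler0 !addr0. Qed.

Lemma half_half x : 2%:R^-1 *: x + 2%:R^-1 *: x = x.
Proof. by rewrite -scalerDr -mulr2n -scaler_nat scalerA mulVr // scale1r. Qed.

Lemma exp_ad_add x y : lie x y = 0 ->
  (forall t, lie x (lie x (lie y t)) = 0) ->
  (forall t, lie x (lie y (lie y t)) = 0) ->
  exp_ad (x + y) = exp_ad x \o exp_ad y.
Proof.
move=> xy xxy xyy; apply/funext => t; rewrite /exp_ad /ad /=.
have yx : lie y (lie x t) = lie x (lie y t) by rewrite [RHS]lie_derivation xy lie0l add0r.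
rewrite !lieDl !lieDr !lieZr !xxy !xyy yx !scaler0 !addr0.
rewrite !scalerDr.
set a := lie x t; set b := lie y t; set c := lie x b.
set p := _ *: lie x a; set q := _ *: lie y b.
rewrite -{3}(half_half c); set r := 2%:R^-1 *: c.
by rewrite [LHS](AC (1*2*(2*2)) (1*3*7*(2*(5*6))*4)).
Qed.

(** The Leibniz rule makes the image of a bracket agree with the bracket of the
    images up to terms of order at least 3 in x, which have to vanish. *)
Lemma exp_ad_aut x : (forall t, lie x (lie x (lie x t)) = 0) -> Aut L (exp_ad x).
Proof.
move=> x3; split.
- move=> a y z; rewrite /exp_ad /ad !lieDr !lieZr !scalerDr !scalerA.
  by rewrite [_ * a]mulrC [LHS](AC (2*2*2) (1*3*5*(2*4*6))).
- exists (exp_ad (- x)) => t.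
    rewrite -[LHS]/((exp_ad (- x) \o exp_ad x) t) -exp_ad_add ?addNr ?exp_ad0 //.
    + by rewrite lieNl liexx oppr0.
    + by move=> u; rewrite !lieNl lieNr opprK.
    + by move=> u; rewrite !lieNl x3 oppr0.
  rewrite -[LHS]/((exp_ad x \o exp_ad (- x)) t) -exp_ad_add ?subrr ?exp_ad0 //.
  + by rewrite lieNr liexx oppr0.
  + by move=> u; rewrite lieNl !lieNr x3 oppr0.
  + by move=> u; rewrite !lieNl !lieNr x3 opprK.
- move=> y z.
  pose y1 := lie x y; pose y2 := lie x y1; pose z1 := lie x z; pose z2 := lie x z1.
  have xz : lie x z = z1 by []. have xz1 : lie x z1 = z2 by [].
  have xz2 : lie x z2 = 0 by exact: x3.
  have d0 v : lie x (lie y v) = lie y1 v + lie y (lie x v).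
    exact: lie_derivation.
  have d1 v : lie x (lie y1 v) = lie y2 v + lie y1 (lie x v).
    exact: lie_derivation.
  have d2 v : lie x (lie y2 v) = lie y2 (lie x v).
    by rewrite lie_derivation (x3 y) lie0l add0r.
  have xy : lie x y = y1 by []. have xy1 : lie x y1 = y2 by [].
  clearbody z2 z1 y2 y1.
  have no3 (u : L) : u + u + u = 0 -> u = 0.
    move=> u3; rewrite -[u]scale1r -(mulVr three_unit) -scalerA scaler_nat.
    by rewrite [u *+ 3]mulrSr mulr2n u3 scaler0.
  (* Expanding (ad x)^3 [y, z] = 0 and (ad x)^3 [y, [x, z]] = 0 by the Leibniz
     rule shows that 3 times the surplus terms of order 3 and 4 vanish. *)
  have o3 : lie y1 z2 + lie y2 z1 = 0.
    apply: no3; have := x3 (lie y z).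
    rewrite !(d0, d1, d2, lieDr, xz, xz1, xz2, lie0r) addr0 => s0; rewrite -[RHS]s0.
    by rewrite [RHS](AC (1*2*(2*1)) (3*1*(5*2)*(6*4))).
  have o4 : lie y2 z2 = 0.
    apply: no3; have := x3 (lie y z1).
    by rewrite !(d0, d1, d2, lieDr, xz1, xz2, lie0r) !addr0.
  rewrite /exp_ad /ad xy xy1 xz xz1 !(d0, d1, lieDr) xz xz1.
  rewrite !lieDl !lieZl !lieZr o4 !scaler0 !addr0.
  rewrite [RHS](AC (3*3*2) (1*(2*4)*(3*5*7)*(8*6))) /= -(scalerDr _ (lie y1 z2)) o3.
  rewrite scaler0 addr0 !scalerDr; congr (_ + _).
  by rewrite addrA -[X in X + _]addrA half_half.
Qed.

Section OneOperator.
Context (E : L) (eulerE : euler_operator E).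
Local Notation D := (ad E).

Lemma lie_gr_same s x y : sign s -> gr D s x -> gr D s y -> lie x y = 0.
Proof.
move=> ss xs ys; apply: (gr_double two_unit three_unit eulerE ss).
exact: lie_gr.
Qed.

(** Bracketing with gr D s raises the degree by s, and only the three degrees
    -s, 0 and s occur. *)
Lemma ad_cube s x y z t : sign s -> gr D s x -> gr D s y -> gr D s z ->
  lie x (lie y (lie z t)) = 0.
Proof.
move=> ss xs ys zs; have [a [b [c [ta tb tc ->]]]] := gr_decomp two_unit eulerE t ss.
have zb : gr D s (lie z b) by rewrite -[s]addr0; exact: lie_gr.
have yzc : gr D s (lie y (lie z c)).
  rewrite -[s]addr0; apply: lie_gr => //; rewrite -(subrr s); exact: lie_gr.
rewrite !lieDr (lie_gr_same ss zs ta) (lie_gr_same ss ys zb).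
by rewrite (lie_gr_same ss xs yzc) !lie0r !addr0.
Qed.

Lemma exp_aut s x : sign s -> gr D s x -> Aut L (exp_ad x).
Proof. by move=> ss xs; apply: exp_ad_aut => t; exact: (ad_cube _ ss). Qed.

Lemma exp_add s x y : sign s -> gr D s x -> gr D s y ->
  exp_ad (x + y) = exp_ad x \o exp_ad y.
Proof.
move=> ss xs ys; apply: exp_ad_add; first exact: lie_gr_same xs ys.
  by move=> t; exact: (ad_cube _ ss).
by move=> t; exact: (ad_cube _ ss).
Qed.

Lemma inv_exp s x : sign s -> gr D s x -> inv_map (exp_ad x) = exp_ad (- x).
Proof.
move=> ss xs; apply: inv_map_uniq; first exact: exp_aut xs.
rewrite -(exp_add ss xs) ?subrr ?exp_ad0 //.
exact: submodN (gr_submodule _ _) _ xs.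
Qed.

Lemma exp_euler s x : sign s -> gr D s x -> exp_ad x E = E - x *~ s.
Proof.
move=> ss xs; have xE : lie x E = - (x *~ s).
  by rewrite lieC; congr (- _); exact: xs.
rewrite /exp_ad /ad xE lieNr -scaler_int lieZr liexx.
by rewrite scaler0 oppr0 scaler0 addr0.
Qed.

Lemma exp_gr s x y : sign s -> gr D s x -> gr D s y -> exp_ad x y = y.
Proof.
move=> ss xs ys; rewrite /exp_ad /ad (lie_gr_same ss xs ys).
by rewrite lie0r scaler0 !addr0.
Qed.

Lemma exp_fil s x : sign s -> gr D s x ->
  flag_act (exp_ad x) (fil D s) = fil D s.
Proof.
move=> ss xs; have nx : gr D s (- x) by apply: submodN => //; exact: gr_submodule.
have stab (V : set L) : (forall y, gr D s y -> forall v, V v -> V (exp_ad y v)) ->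
    exp_ad x @` V = V.
  move=> Vs; apply/seteqP; split=> [_ [v Vv <-]|v Vv]; first exact: Vs.
  exists (exp_ad (- x) v); first exact: Vs.
  by rewrite -(inv_exp ss xs) (autVK (exp_aut ss xs)).
rewrite /flag_act /fil /= !stab // => y ys v.
  move=> [b b0 [c cs <-]]; rewrite (autD (exp_aut ss ys)) (exp_gr ss ys cs).
  exists b => //; exists (lie y b + 2%:R^-1 *: lie y (lie y b) + c); last first.
    by rewrite /exp_ad /ad !addrA.
  have S := gr_submodule E s.
  have yb : gr D s (lie y b) by rewrite -[s]addr0; exact: lie_gr.
  by rewrite (lie_gr_same ss ys yb) scaler0 addr0; apply: submodD.
by move=> vs; rewrite (exp_gr ss ys vs).
Qed.

(** The exponential of z in gr D s moves E by a multiple of z, whereas E lies in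
    (fil D (- s)).2, which meets gr D s trivially. *)
Lemma exp_fil_inj s x y : sign s -> gr D s x -> gr D s y ->
  flag_act (exp_ad x) (fil D (- s)) = flag_act (exp_ad y) (fil D (- s)) -> x = y.
Proof.
move=> ss xs ys; have S := gr_submodule E s.
have ny : gr D s (- y) by exact: submodN.
move=> /(congr1 (flag_act (exp_ad (- y)))).
rewrite -!flag_act_comp -!(exp_add ss) // addNr exp_ad0 flag_act_id => fix_.
have zs : gr D s (- y + x) by exact: submodD.
have : (fil D (- s)).2 (exp_ad (- y + x) E).
  by rewrite -fix_; exists E => //; apply: gr0_fil; exact: euler_gr0.
rewrite (exp_euler ss zs) => fE; apply/eqP; rewrite -subr_eq0 addrC.
have : (fil D (- s)).2 ((- y + x) *~ s).
  have F := fil_submodule E (- s).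
  rewrite -[_ *~ s]opprK; apply: submodN => //.
  rewrite -[X in _ X]add0r -[X in X + _](subrr E) addrAC; apply: submodB => //.
  by apply: gr0_fil; exact: euler_gr0.
move=> /(gr_fil_disj two_unit ss (submodMz S s zs)).
by case: ss => ->; rewrite ?mulrNz mulr1z => /eqP; rewrite ?oppr_eq0.
Qed.

End OneOperator.

End Exponentials.

(** * Filtrations transversal to a given one *)

Section Transversality.
Context {K : comUnitRingType} {L : lieAlgType K}.
Context (two_unit : (2%:R : K) \is a GRing.unit).
Context (three_unit : (3%:R : K) \is a GRing.unit).
Implicit Types (E x y t : L) (s : int) (e f : flag L).

Lemma transversal_sym e f : transversal e f -> transversal f e.
Proof. by case. Qed.

Section OneOperator.
Context (E : L) (eulerE : euler_operator E).
Local Notation D := (ad E).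

(** The projections of a grading are polynomials in D. *)
Lemma submodule_pr (V : set L) i x : is_submodule V ->
  (forall v, V v -> V (D v)) -> V x -> V (pr D i x).
Proof.
move=> VP DV Vx; rewrite /pr; case: eqP => _.
  by apply: submodB => //; exact/DV/DV.
by apply: submodZ => //; apply: submodD => //; [exact/DV/DV|by apply: submodMz => //; exact: DV].
Qed.

Lemma submodule_graded (V : set L) s x : is_submodule V ->
  (forall v, V v -> V (D v)) -> sign s -> V x ->
  exists a b c, [/\ V a /\ gr D s a, V b /\ gr D 0 b, V c /\ gr D (- s) c &
                    x = a + b + c].
Proof.
move=> VP DV ss Vx.
have [a [b [c [sa sb sc xE]]]] := gr_decomp two_unit eulerE x ss.
have [pa pb pc] := pr_gr two_unit ss sa sb sc.
exists a, b, c; split=> //; split=> //.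
- by rewrite -pa -xE; exact: submodule_pr.
- by rewrite -pb -xE; exact: submodule_pr.
- by rewrite -pc -xE; exact: submodule_pr.
Qed.

(** A flag preserved by D is a sum of homogeneous parts; transversality leaves
    no room in the degrees of fil D s. *)
Lemma graded_transversal s e : sign s ->
  is_submodule e.1 -> is_submodule e.2 ->
  (forall v, e.1 v -> e.1 (D v)) -> (forall v, e.2 v -> e.2 (D v)) ->
  transversal e (fil D s) -> e = fil D (- s).
Proof.
case: e => e1 e0 /= ss e1P e0P De1 De0 [[/= s1 i1] [/= s0 i0]].
have tri1 v : e1 v -> (fil D s).2 v -> v = 0.
  by move=> ev fv; have : (e1 `&` (fil D s).2) v by []; rewrite i1.
have tri0 v : gr D s v -> e0 v -> v = 0.
  by move=> ev fv; have : (gr D s `&` e0) v by []; rewrite i0.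
have sub1 v : e1 v -> gr D (- s) v.
  move=> ev; have [a [b [c [[ea sa] [eb sb] [_ sc] ->]]]] := submodule_graded e1P De1 ss ev.
  by rewrite (tri1 a ea (sub_fil sa)) (tri1 b eb (gr0_fil s sb)) !add0r.
have sub0 v : e0 v -> (fil D (- s)).2 v.
  move=> ev; have [a [b [c [[ea sa] [_ sb] [_ sc] ->]]]] := submodule_graded e0P De0 ss ev.
  by rewrite (tri0 a sa ea) add0r; exists b => //; exists c.
have ns := sign_opp ss.
congr pair; apply/seteqP; split=> v /=; [exact: sub1| |exact: sub0|].
  move=> vs; have : [set: L] v by []; rewrite -s1 => -[a ea [b fb abE]].
  suff b0 : b = 0 by move: ea; rewrite -abE b0 addr0.
  apply: (gr_fil_disj two_unit ns); last by rewrite opprK; exact: fb.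
  have -> : b = v - a by rewrite -abE addrAC subrr add0r.
  by apply: submodB; [exact: gr_submodule|exact: vs|exact: sub1].
move=> vs; have : [set: L] v by []; rewrite -s0 => -[a sa [b eb abE]].
suff a0 : a = 0 by move: eb; rewrite -abE a0 add0r.
apply: (gr_fil_disj two_unit ss sa).
have -> : a = v - b by rewrite -abE addrK.
by apply: (submodB (fil_submodule E (- s))); [exact: vs|exact: sub0].
Qed.

End OneOperator.

(** This is the rule [f_0, f_i] <= f_i, used to see that an Euler operator lying
    in f_0 acts on the flag. *)
Lemma fil_stable E (f v : L) : euler_operator E -> (fil (ad E) 1).2 f ->
  ((fil (ad E) 1).1 v -> (fil (ad E) 1).1 (lie f v)) /\
  ((fil (ad E) 1).2 v -> (fil (ad E) 1).2 (lie f v)).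
Proof.
move=> eE [b b0 [c c1 <-]]; have F := fil_submodule E 1.
have s1 : sign 1 by left.
have st w : gr (ad E) 1 w -> gr (ad E) 1 (lie (b + c) w).
  move=> w1; rewrite lieDl (lie_gr_same two_unit three_unit eE s1 c1 w1) addr0.
  by rewrite -[1]add0r; exact: lie_gr.
split; first exact: st.
move=> [b' b0' [c' c1' <-]]; rewrite lieDr; apply: submodD => //; last first.
  by apply: sub_fil; exact: st.
rewrite lieDl; apply: submodD => //.
  by apply: gr0_fil; rewrite -[0](addr0 0); exact: lie_gr.
by apply: sub_fil; rewrite -[1]addr0; exact: lie_gr.
Qed.

(** Decompose E = x + f along gr D s and e.2.  Then f = E - x is the translate
    of E by the exponential of s x; it is therefore an Euler operator with
    the same filtration fil D s, and since it lies in e.2 it preserves e.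
    So e is the filtration opposite to fil D s with respect to f. *)
Lemma transversal_exp E s e : euler_operator E -> sign s ->
  inner_filtrations L e -> transversal e (fil (ad E) s) ->
  exists2 x, gr (ad E) s x & e = flag_act (exp_ad x) (fil (ad E) (- s)).
Proof.
move=> eE ss [_ [E' eE' <-] <-] tr; have [_ [/= sum _]] := tr.
have : [set: L] E by []; rewrite -sum => -[x xs [f ff xfE]].
have zs : gr (ad E) s (x *~ s) by apply: submodMz => //; exact: gr_submodule.
have gA := exp_aut two_unit three_unit eE ss zs.
have gE : exp_ad (x *~ s) E = f.
  rewrite (exp_euler ss zs) -mulrzA.
  have -> : s * s = 1 by case: ss => ->.
  by rewrite mulr1z -{1}xfE addrAC subrr add0r.
exists (x *~ s) => //; rewrite -fil_aut // gE.
have ef : euler_operator f by rewrite -gE; exact: euler_aut.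
apply: graded_transversal => //; try exact: gr_submodule; try exact: fil_submodule.
- by move=> v; have [h _] := fil_stable v eE' ff.
- by move=> v; have [_ h] := fil_stable v eE' ff.
- by rewrite -gE fil_aut // (exp_fil two_unit three_unit eE ss zs).
Qed.

Lemma exp_transversal E s x : euler_operator E -> sign s -> gr (ad E) s x ->
  transversal (flag_act (exp_ad x) (fil (ad E) (- s))) (fil (ad E) s).
Proof.
move=> eE ss xs; rewrite -(exp_fil two_unit three_unit eE ss xs).
apply: transversal_aut; first exact: exp_aut xs.
by apply: transversal_sym; exact: fil_transversal.
Qed.

Lemma pr_fil E s v : euler_operator E -> sign s ->
  pr (ad E) s v = 0 <-> (fil (ad E) (- s)).2 v.
Proof.
move=> eE ss; have [a [b [c [sa sb sc ->]]]] := gr_decomp two_unit eE v ss.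
have [-> _ _] := pr_gr two_unit ss sa sb sc; split=> [->|fv].
  by rewrite add0r; exists b => //; exists c.
apply: (gr_fil_disj two_unit ss sa); have F := fil_submodule E (- s).
have -> : a = a + b + c - (b + c) by rewrite -[a + b + c]addrA addrK.
by apply: submodB => //; exists b => //; exists c.
Qed.

(** Along (fil D (- s)).2 the module L projects onto gr D s, so a complement
    of (fil D (- s)).2 is a submodule that this projection maps bijectively. *)
Lemma decomp_component E s g : euler_operator E -> sign s -> Aut L g ->
  direct_decomp (g @` gr (ad E) s) (fil (ad E) (- s)).2 <->
  GL (gr (ad E) s) (component (ad E) s s g).
Proof.
move=> eE ss gA; set D := ad E; have S := gr_submodule E s.
have mem_s : s \in [:: 1; 0; -1] by case: ss => ->.
have prs x : gr D s x -> pr D s x = x by exact: pr_id.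
have prI x : gr D s (pr D s x) by exact: pr_in.
have prB x y : pr D s (x - y) = pr D s x - pr D s y.
  have DD : {morph D : u v / u + v} by move=> u v; exact: lieDr.
  by apply/eqP; rewrite eq_sym subr_eq -prD // subrK.
have compE x : gr D s x -> component D s s g x = pr D s (g x).
  by move=> xs; rewrite /component /= (prs x xs).
have comp_fil x y : gr D s x -> gr D s y ->
    component D s s g x = component D s s g y -> (fil D (- s)).2 (g (x - y)).
  by move=> xs ys; rewrite !compE // => xy; apply/(pr_fil _ eE ss); rewrite (autB gA) prB xy subrr.
split.
  move=> [sum int]; split; first by move=> a x y _ _; exact: linear_component.
  split.
  - by move=> x xs /=; exact: prI.
  - move=> x y /set_mem xs /set_mem ys /(comp_fil _ _ xs ys) fxy.
    have : ((g @` gr D s) `&` (fil D (- s)).2) (g (x - y)).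
      by split=> //; exists (x - y) => //; exact: submodB.
    rewrite int => /= gxy; apply/eqP; rewrite -subr_eq0; apply/eqP.
    by apply: (aut_inj gA); rewrite gxy aut0.
  - move=> y ys; have : [set: L] y by []; rewrite -sum => -[_ [x xs <-] [f ff xfE]].
    exists x => //; rewrite compE // -[RHS]prs // -xfE prD; last by move=> u v; exact: lieDr.
    by rewrite [pr D s f](pr_fil _ eE ss).2 // addr0.
move=> [_ [_ inj surj]]; split; apply/seteqP; split=> // v.
- move=> _; have [x xs xv] := surj _ (prI v).
  exists (g x); first by exists x.
  exists (v - g x); last by rewrite addrC subrK.
  by apply/(pr_fil _ eE ss); rewrite prB -compE // xv subrr.
- move=> [[x xs <-] fx]; suff -> : x = 0 by rewrite /= aut0.
  apply: inj; [exact: mem_set|by apply/mem_set; exact: S.1|].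
  rewrite !compE //; last exact: S.1.
  rewrite (pr_fil _ eE ss).2 // aut0 // prs //; exact: S.1.
- by move=> ->; split; [exists 0; [exact: S.1|exact: aut0]|exact: (fil_submodule _ _).1].
Qed.

End Transversality.

(** * The projective elementary group *)

Section ElementaryGroup.
Context {K : comUnitRingType} {L : lieAlgType K}.
Context (two_unit : (2%:R : K) \is a GRing.unit).
Context (three_unit : (3%:R : K) \is a GRing.unit).
Context (E : L) (eulerE : euler_operator E).
Implicit Types (x y v w : L) (s : int) (e f : flag L) (g h a : L -> L).
Local Notation D := (ad E).
Local Notation G := (elementary_group (ad E)).

Let expA s x : sign s -> gr D s x -> Aut L (exp_ad x).
Proof. exact: exp_aut. Qed.

Let negs s x : gr D s x -> gr D s (- x).
Proof. exact: submodN (gr_submodule _ _) x. Qed.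

Let sgn1 : sign 1. Proof. by left. Qed.
Let sgnN : sign (-1). Proof. by right. Qed.

Lemma elementary_group_subgroup : Aut_subgroup G.
Proof.
apply: smallest_subgroup => _ [x xs <-].
by case: xs; apply: expA; [left|right].
Qed.

Lemma elementary_aut g : G g -> Aut L g.
Proof. by case: elementary_group_subgroup => h _ _ _ /h. Qed.

Lemma elementary_id : G id.
Proof. by case: elementary_group_subgroup. Qed.

Lemma elementary_comp g h : G g -> G h -> G (g \o h).
Proof. by case: elementary_group_subgroup => _ _ c _; exact: c. Qed.

Lemma elementary_inv g : G g -> G (inv_map g).
Proof. by case: elementary_group_subgroup => _ _ _; apply. Qed.

Lemma elementary_exp s x : sign s -> gr D s x -> G (exp_ad x).
Proof.
move=> ss xs A [_]; apply; exists x => //.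
by case: ss xs => ->; [left|right].
Qed.

Lemma aut_gr_ad g : Aut L g -> g \o D = D \o g <-> ad (g E) = D.
Proof. by move=> gA; rewrite -conj_ad //; have [] := conj_act_fixed D gA; split. Qed.

Lemma aut_gr_fil g s : Aut_gr D g -> flag_act g (fil D s) = fil D s.
Proof. by case=> gA gD; rewrite -fil_aut //; move/(aut_gr_ad gA): gD => ->. Qed.

Lemma aut_gr_gr g s x : Aut_gr D g -> gr D s x -> gr D s (g x).
Proof.
move=> [gA gD] xs; rewrite /gr /=; have := congr1 (@^~ x) gD; rewrite /= => <-.
by rewrite [D x]xs autMz.
Qed.

Lemma fil_aut_gr g s : sign s -> Aut L g ->
  flag_act g (fil D s) = fil D s -> flag_act g (fil D (- s)) = fil D (- s) ->
  Aut_gr D g.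
Proof.
move=> ss gA g1 g2; split=> //; apply/(aut_gr_ad gA).
apply: (fil_inj two_unit ss) => //; first exact: euler_aut.
  by rewrite fil_aut.
by rewrite fil_aut.
Qed.

Lemma aut_gr_inv g : Aut_gr D g -> Aut_gr D (inv_map g).
Proof.
move=> gG; have [gA _] := gG.
by apply: (@fil_aut_gr _ 1) => //; [exact: aut_inv|..];
  rewrite -[X in flag_act _ X](aut_gr_fil _ gG) flag_actK.
Qed.

(** For h in H this moves exponentials across h, so that H U = U H. *)
Lemma exp_conj g x : Aut L g -> g \o exp_ad x = exp_ad (g x) \o g.
Proof.
move=> gA; apply/funext => y; rewrite /exp_ad /ad /= !(autD gA) (autZ gA).
by rewrite !(aut_lie gA).
Qed.

Lemma H_stab s : sign s ->
  H D = [set g | [/\ G g, flag_act g (fil D s) = fil D s &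
                       flag_act g (fil D (- s)) = fil D (- s)]].
Proof.
move=> ss; apply/seteqP; split=> g; first by move=> [Gg gG]; split=> //; exact: aut_gr_fil.
by move=> [Gg g1 g2]; split=> //; apply: fil_aut_gr g1 g2 => //; exact: elementary_aut.
Qed.

Lemma H_inv h : H D h -> H D (inv_map h).
Proof. by move=> [Gh hG]; split; [exact: elementary_inv|exact: aut_gr_inv]. Qed.

Lemma H_aut h : H D h -> Aut L h.
Proof. by case=> /elementary_aut. Qed.

(** The stabilizer of fil D s acts on the filtrations transversal to it, and by
    [transversal_exp] the exponentials of gr D s do so transitively. *)
Lemma P_stab s : sign s ->
  P D s = [set g | G g /\ flag_act g (fil D s) = fil D s].
Proof.
move=> ss; apply/seteqP; split=> g.
  move=> [h hH [_ [x xs <-] <-]]; have [Gh hG] := hH; split.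
    by apply: elementary_comp => //; exact: elementary_exp xs.
  by rewrite flag_act_comp (exp_fil two_unit three_unit eulerE ss xs) aut_gr_fil.
move=> [Gg gs]; have gA := elementary_aut Gg.
have [||x xs ge] := transversal_exp two_unit three_unit eulerE ss
    (e := flag_act g (fil D (- s))).
- by apply: inner_aut => //; apply: fil_inner => //; exact: sign_opp.
- rewrite -gs; apply: transversal_aut => //; apply: transversal_sym.
  exact: fil_transversal.
pose h := exp_ad (- x) \o g.
have hH : H D h.
  rewrite (H_stab ss); split.
  - by apply: elementary_comp => //; apply: (elementary_exp ss); exact: negs.
  - by rewrite flag_act_comp gs (exp_fil two_unit three_unit eulerE ss) //; exact: negs.
  - by rewrite flag_act_comp ge -(inv_exp two_unit three_unit eulerE ss xs)
      flag_actK //; exact: expA xs.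
have hV := H_inv hH; have hA := H_aut hH.
exists h => //; exists (exp_ad (inv_map h x)).
  by exists (inv_map h x) => //; apply: aut_gr_gr => //; case: hV.
rewrite exp_conj // autVK // /h compA.
by rewrite -(exp_add two_unit three_unit eulerE ss xs (negs xs)) subrr exp_ad0.
Qed.

Lemma P_capU s : sign s -> P D s `&` U D (- s) = [set id].
Proof.
move=> ss; have ns := sign_opp ss; apply/seteqP; split=> g.
  rewrite P_stab // => -[[Gg gs] [x xs xg]]; move: gs; rewrite -xg => gs.
  suff -> : x = 0 by rewrite /= exp_ad0.
  apply: (exp_fil_inj two_unit three_unit eulerE ns xs).
    exact: (gr_submodule _ _).1.
  by rewrite exp_ad0 flag_act_id opprK.
move=> ->; split; first by rewrite P_stab //; split; [exact: elementary_id|exact: flag_act_id].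
by exists 0; [exact: (gr_submodule _ _).1|exact: exp_ad0].
Qed.

Lemma P_capP : P D 1 `&` P D (-1) = H D.
Proof.
rewrite (H_stab sgn1) (P_stab sgn1) (P_stab sgnN).
by apply/seteqP; split=> g; [move=> [[Gg g1] [_ g2]]|move=> [Gg g1 g2]].
Qed.

(** Fixing fil D s means moving E, modulo the center, only within the orbit
    E + gr D s of the exponentials of gr D s. *)
Lemma P_euler s : sign s ->
  P D s = [set g | G g /\ exists2 x, gr D s x & ad (g E) = ad (E + x)].
Proof.
move=> ss; have S := gr_submodule E s; apply/seteqP; split=> g.
  move=> Pg; have := Pg; rewrite P_stab // => -[Gg _]; split=> //.
  have [h hH [_ [x xs <-] <-]] := Pg; have [Gh hG] := hH; have hA := H_aut hH.
  exists (- (h x *~ s)).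
    by apply: negs; apply: submodMz => //; exact: aut_gr_gr.
  have hx := aut_gr_gr hG xs.
  rewrite exp_conj //= -conj_ad; last exact: expA hx.
  rewrite (_ : ad (h E) = D); last by apply/(aut_gr_ad hA); case: hG.
  by rewrite conj_ad ?(exp_euler ss hx) //; exact: expA hx.
move=> [Gg [x xs gx]]; rewrite P_stab //; split=> //.
have gA := elementary_aut Gg.
have zs : gr D s (- (x *~ s)) by apply: negs; exact: submodMz.
rewrite -fil_aut // gx -[RHS](exp_fil two_unit three_unit eulerE ss zs).
rewrite -fil_aut; last exact: expA zs.
rewrite (exp_euler ss zs) mulNrz opprK -mulrzA.
by have -> : s * s = 1 by case: ss => ->.
Qed.

Lemma P_conj s : sign s ->
  P D s = [set g | G g /\ [set ad x | x in gr D s] (conj_act g D \- D)].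
Proof.
move=> ss; rewrite P_euler //; apply/seteqP; split=> g [Gg].
  move=> [x xs gx]; split=> //; exists x => //; rewrite conj_ad ?gx; last exact: elementary_aut.
  by apply/funext => y; rewrite /= /ad lieDl [lie E y + _]addrC addrK.
move=> [x xs gx]; split=> //; exists x => //; apply/funext => y.
have := congr1 (@^~ y) gx; rewrite conj_ad; last exact: elementary_aut.
by rewrite /= /ad lieDl => ->; rewrite addrC subrK.
Qed.

Lemma P_center s : sign s ->
  P D s = [set g | G g /\ msum (center L) (gr D s) (g E - E)].
Proof.
move=> ss; rewrite P_euler //; apply/seteqP; split=> g [Gg].
  move=> [x xs /ad_inj_center gx]; split=> //; exists (g E - (E + x)) => //.
  by exists x => //; rewrite opprD addrA subrK.
move=> [z zz [x xs zx]]; split=> //; exists x => //; apply/ad_inj_center.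
by rewrite opprD addrA -zx addrK.
Qed.

(** ** Transversal pairs and affine charts *)

Lemma inner_transversal_fil s :  sign s ->
  [set f | inner_filtrations L f /\ transversal f (fil D s)] =
  [set flag_act (exp_ad x) (fil D (- s)) | x in gr D s].
Proof.
move=> ss; apply/seteqP; split=> f.
  move=> [fi ft]; have [x xs ->] := transversal_exp two_unit three_unit eulerE ss fi ft.
  by exists x.
move=> [x xs <-]; split; last exact: exp_transversal.
by apply: inner_aut; [exact: expA xs|apply: fil_inner => //; exact: sign_opp].
Qed.

(** Translating by the inverse of g reduces to filtrations transversal to the
    base point, which are translates of the opposite base point by exponentials;
    these lie in G and fix fil D s. *)
Lemma transversal_orbit s f g : sign s -> G g -> inner_filtrations L f ->
  transversal f (flag_act g (fil D s)) ->
  exists2 k, G k & flag_act k (fil D (- s)) = f /\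
                   flag_act k (fil D s) = flag_act g (fil D s).
Proof.
move=> ss Gg fi ft; have gA := elementary_aut Gg.
have [||x xs ge] := transversal_exp two_unit three_unit eulerE ss
    (e := flag_act (inv_map g) f).
- by apply: inner_aut => //; exact: aut_inv.
- by rewrite -[fil D s](flag_actK _ gA); apply: transversal_aut => //; exact: aut_inv.
exists (g \o exp_ad x).
  by apply: elementary_comp => //; exact: elementary_exp xs.
rewrite 2!flag_act_comp -ge flag_actVK //.
by rewrite (exp_fil two_unit three_unit eulerE ss xs).
Qed.

Lemma transversals_affine :
  affine_space (gr D 1) (transversals (fil D 1)) (fun x f => flag_act (exp_ad x) f).
Proof.
have -> : transversals (fil D 1) =
    [set flag_act (exp_ad x) (fil D (-1)) | x in gr D 1].
  exact: inner_transversal_fil.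
have S := gr_submodule E 1; have eA := exp_add two_unit three_unit eulerE sgn1.
split=> //; split.
  by exists (fil D (-1)); exists 0; [exact: S.1|rewrite exp_ad0 flag_act_id].
split.
  move=> x _ xs [y ys <-]; exists (x + y); first exact: submodD.
  by rewrite eA // flag_act_comp.
split; first by move=> f _; rewrite exp_ad0 flag_act_id.
split; first by move=> x y f xs ys _; rewrite eA // flag_act_comp.
move=> _ _ [x xs <-] [y ys <-]; exists (y - x); split.
  split; first exact: submodB.
  rewrite -flag_act_comp -eA ?subrK //; exact: submodB.
move=> z [zs]; rewrite -flag_act_comp -eA // => /(exp_fil_inj two_unit three_unit eulerE sgn1).
by move=> <- //; [rewrite addrK|exact: submodD].
Qed.

(** ** The big cell *)

(** The parameter v is read off the image of fil D (-1), and w off the image of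
    fil D 1 under the inverse.  For the existence of a factorization, an
    exponential brings g into the stabilizer of fil D (-1). *)
Lemma big_cell :
  set_bij (gr D 1 `*` H D `*` gr D (-1)) (Omega_plus D)
     (fun p : L * (L -> L) * L => exp_ad p.1.1 \o p.1.2 \o exp_ad p.2).
Proof.
split.
- move=> [[v h] w] [[/= vs hH] ws]; have [Gh hG] := hH; split.
    apply: elementary_comp; last exact: elementary_exp ws.
    by apply: elementary_comp => //; exact: elementary_exp vs.
  exists v => //.
  by rewrite 2!flag_act_comp (exp_fil two_unit three_unit eulerE sgnN ws) (aut_gr_fil _ hG).
- move=> [[v h] w] [[v' h'] w'] /set_mem[[/= vs hH] ws] /set_mem[[/= vs' hH'] ws'] eq_.
  have [[Gh hG] [Gh' hG']] := (hH, hH').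
  have vv : v = v'.
    apply: (exp_fil_inj two_unit three_unit eulerE sgn1 vs vs').
    have := congr1 (@^~ (fil D (-1))) (congr1 (@flag_act K L) eq_).
    rewrite 4!flag_act_comp (exp_fil two_unit three_unit eulerE sgnN ws).
    by rewrite (exp_fil two_unit three_unit eulerE sgnN ws') (aut_gr_fil _ hG) (aut_gr_fil _ hG').
  subst v'; have hw : h \o exp_ad w = h' \o exp_ad w'.
    apply/funext => y; apply: (aut_inj (expA sgn1 vs)).
    exact: (congr1 (@^~ y) eq_).
  have ww : w = w'.
    apply: oppr_inj; apply: (exp_fil_inj two_unit three_unit eulerE sgnN) => //;
      try exact: negs.
    have := congr1 (fun g => flag_act (inv_map g) (fil D 1)) hw.
    rewrite (inv_map_comp (H_aut hH) (expA sgnN ws)) (inv_map_comp (H_aut hH') (expA sgnN ws')).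
    rewrite (inv_exp two_unit three_unit eulerE sgnN ws) (inv_exp two_unit three_unit eulerE sgnN ws').
    rewrite (flag_act_comp (exp_ad (- w))) (flag_act_comp (exp_ad (- w'))).
    by rewrite (aut_gr_fil _ (aut_gr_inv hG)) (aut_gr_fil _ (aut_gr_inv hG')).
  subst w'; congr (_, _, _); apply/funext => y.
  have := congr1 (@^~ (inv_map (exp_ad w) y)) hw.
  by rewrite /= autVK //; exact: expA ws.
- move=> g [Gg [v vs gv]].
  have : P D (-1) (exp_ad (- v) \o g).
    rewrite P_stab //; split.
      by apply: elementary_comp => //; apply: (elementary_exp sgn1); exact: negs.
    rewrite flag_act_comp -gv -(inv_exp two_unit three_unit eulerE sgn1 vs).
    by rewrite flag_actK //; exact: expA vs.
  move=> [h hH [_ [w ws <-] hwg]]; exists (v, h, w) => //=.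
  rewrite -compA hwg compA -(exp_add two_unit three_unit eulerE sgn1 vs (negs vs)).
  by rewrite subrr exp_ad0.
Qed.

(** That g maps fil D (-1) to a flag transversal to fil D 1 amounts to two
    direct decompositions, one of which is carried by the inverse of g to a
    decomposition with the roles of the two signs exchanged. *)
Lemma Omega_plus_denominators :
  Omega_plus D = [set g | [/\ G g, GL (gr D 1) (denom D g 0)
                             & GL (gr D (-1)) (codenom D g 0)]].
Proof.
have VE : Vplus D = transversals (fil D 1) by exact: esym (inner_transversal_fil sgn1).
have dE g : denom D g 0 = component D 1 1 (inv_map g).
  by rewrite /denom oppr0 exp_ad0.
have cE g : codenom D g 0 = component D (-1) (-1) g by rewrite /codenom exp_ad0.
rewrite /Omega_plus VE; apply/seteqP; split=> g /=.
  move=> [Gg [_ [t1 t2]]]; have gA := elementary_aut Gg; have gV := aut_inv gA.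
  split=> //; rewrite ?dE ?cE; apply/decomp_component => //.
  have := direct_decomp_aut gV t2.
  by rewrite /= image_comp autVo // image_id.
move=> [Gg]; rewrite dE cE => /decomp_component t2 /decomp_component t1.
have gA := elementary_aut Gg; have gV := aut_inv gA.
split=> //; split; first by apply: inner_aut => //; exact: fil_inner.
split; first exact: t1.
have := direct_decomp_aut gA (t2 two_unit eulerE sgn1 gV).
by rewrite /= image_comp autoV // image_id.
Qed.

(** ** Normalizing automorphisms *)

(** Conjugation by an automorphism commuting with D permutes the generators. *)
Lemma elementary_normal a g : Aut_gr D a -> G g -> G (a \o g \o inv_map a).
Proof.
move=> aG Gg; have [aA _] := aG; have aV := aut_inv aA.
pose N : set (L -> L) := [set k | Aut L k /\ G (a \o k \o inv_map a)].
suff [] : N g by [].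
apply: Gg; split; last first.
  move=> _ [x xs <-].
  have [s ss {}xs] : exists2 s, sign s & gr D s x by case: xs; [exists 1|exists (-1)].
  split; first exact: expA xs.
  rewrite exp_conj // -compA autoV //.
  by apply: (elementary_exp ss); exact: aut_gr_gr.
split.
- by move=> k [].
- split; first exact: aut_id.
  by rewrite -[a \o id]/a autoV //; exact: elementary_id.
- move=> k l [kA Gk] [lA Gl]; split; first exact: aut_comp.
  rewrite (_ : _ \o _ = (a \o k \o inv_map a) \o (a \o l \o inv_map a)).
    exact: elementary_comp.
  by apply/funext => x /=; rewrite autK.
- move=> k [kA Gk]; have kV := aut_inv kA; split=> //.
  have <- : inv_map (a \o k \o inv_map a) = a \o inv_map k \o inv_map a.
    by rewrite (inv_map_comp (aut_comp aA kA) aV) (inv_map_comp aA kA) (inv_mapI aA).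
  exact: elementary_inv.
Qed.

(** If a fixes the base point t, then a g t = (a g a^-1) t. *)
Lemma aut_gr_orbit T (act : (L -> L) -> T -> T) t a u : is_action act ->
  (forall b, Aut_gr D b -> act b t = t) -> Aut_gr D a ->
  orbit_of G act t u -> orbit_of G act t (act a u).
Proof.
move=> [act1 actM] fix_t aG [g Gg <-]; have [aA _] := aG; have gA := elementary_aut Gg.
have aV := aut_inv aA.
exists (a \o g \o inv_map a); first exact: elementary_normal.
rewrite (actM _ _ _ (aut_comp aA gA) aV) (fix_t _ (aut_gr_inv aG)).
exact: actM.
Qed.

Lemma elementary_orbit T (act : (L -> L) -> T -> T) t g u : is_action act ->
  G g -> orbit_of G act t u -> orbit_of G act t (act g u).
Proof.
move=> [act1 actM] Gg [k Gk <-]; exists (g \o k); first exact: elementary_comp.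
by apply: actM; exact: elementary_aut.
Qed.

Lemma h_scaleE r x y z : gr D 1 x -> gr D 0 y -> gr D (-1) z ->
  h_scale D r (x + y + z) = r *: x + y + r^-1 *: z.
Proof. by move=> xs ys zs; rewrite /h_scale; have [-> -> ->] := pr_gr two_unit sgn1 xs ys zs. Qed.

(** A bracket of homogeneous elements is scaled by the product of their scalars,
    the brackets in degrees 2 and -2 being zero. *)
Lemma h_scale_aut_gr r : r \is a GRing.unit -> Aut_gr D (h_scale D r).
Proof.
move=> ru; have decomp x := gr_decomp two_unit eulerE x sgn1.
have S i := gr_submodule E i.
have cancel_h q : q \is a GRing.unit -> cancel (h_scale D q) (h_scale D q^-1).
  move=> qu x; have [x1 [x0 [xn [s1 s0 sn ->]]]] := decomp x.
  rewrite (h_scaleE q) // h_scaleE ?invrK //; try exact: submodZ.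
  by rewrite !scalerA mulVr ?mulrV // !scale1r.
split; last first.
  apply/funext => x /=; have [x1 [x0 [xn [s1 s0 sn ->]]]] := decomp x.
  have DE y1 y0 yn : gr D 1 y1 -> gr D 0 y0 -> gr D (-1) yn ->
      D (y1 + y0 + yn) = y1 + 0 - yn.
    by rewrite /gr /= /ad !lieDr => -> -> ->; rewrite mulrNz.
  rewrite (DE _ _ _ s1 s0 sn) !h_scaleE //; try exact: (S _).1; try exact: submodN.
  by rewrite DE ?scalerN //; exact: submodZ.
split.
- move=> b x y; have [x1 [x0 [xn [s1 s0 sn ->]]]] := decomp x.
  have [y1 [y0 [yn [t1 t0 tn ->]]]] := decomp y.
  have -> : b *: (x1 + x0 + xn) + (y1 + y0 + yn) =
      (b *: x1 + y1) + (b *: x0 + y0) + (b *: xn + yn).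
    by rewrite !scalerDr (AC (3*3) (1*4*(2*5)*(3*6))).
  rewrite !h_scaleE //; try exact: (S _).2.
  rewrite !scalerDr !scalerA ![_ * b]mulrC.
  by rewrite [LHS](AC (2*2*2) (1*3*5*(2*4*6))).
- exists (h_scale D r^-1); first exact: cancel_h.
  by move=> x; rewrite -{1}[r]invrK cancel_h // unitrV.
- move=> x y; have [x1 [x0 [xn [s1 s0 sn ->]]]] := decomp x.
  have [y1 [y0 [yn [t1 t0 tn ->]]]] := decomp y.
  have l2 : lie x1 y1 = 0 by exact: lie_gr_same s1 t1.
  have ln2 : lie xn yn = 0 by exact: lie_gr_same sn tn.
  have lg i j k u v : gr D i u -> gr D j v -> i + j = k -> gr D k (lie u v).
    by move=> ui vj <-; exact: lie_gr.
  have -> : lie (x1 + x0 + xn) (y1 + y0 + yn) =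
     (lie x1 y0 + lie x0 y1) + (lie x1 yn + lie x0 y0 + lie xn y1) +
     (lie x0 yn + lie xn y0).
    rewrite !lieDl !lieDr l2 ln2 add0r addr0.
    by rewrite [LHS](AC (2*3*2) (1*3*(2*4*6)*(5*7))).
  rewrite !h_scaleE //; first last.
  + by apply: submodD => //; [exact: lg s0 tn _|exact: lg sn t0 _].
  + apply: submodD => //; last exact: lg sn t1 _.
    by apply: submodD => //; [exact: lg s1 tn _|exact: lg s0 t0 _].
  + by apply: submodD => //; [exact: lg s1 t0 _|exact: lg s0 t1 _].
  rewrite !lieDl !lieDr !lieZl !lieZr l2 ln2 !scaler0 add0r addr0.
  rewrite !scalerA mulrV // mulVr // !scale1r !scalerDr.
  by rewrite [RHS](AC (2*3*2) (1*3*(2*4*6)*(5*7))).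
Qed.

Lemma ext_orbit T (act : (L -> L) -> T -> T) t : is_action act ->
  (forall b, Aut_gr D b -> act b t = t) ->
  stable_under (ext_elementary_group D) act (orbit_of G act t).
Proof.
move=> actP fix_t; apply: stable_smallest => //.
  move=> g [/elementary_aut//|[r ru <-]].
  by have [] := h_scale_aut_gr ru.
move=> g u [Gg|[r ru <-]] ut.
  by split; apply: elementary_orbit => //; exact: elementary_inv.
have hG := h_scale_aut_gr ru.
by split; apply: aut_gr_orbit => //; exact: aut_gr_inv.
Qed.

End ElementaryGroup.

(** * Orbits, charts and the big cell *)

Theorem theorem1p12 (K : comUnitRingType)
  (two_unit : (2%:R : K) \is a GRing.unit)
  (three_unit : (3%:R : K) \is a GRing.unit)
  (L : lieAlgType K) (E : L) (eulerE : euler_operator E) :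
  let D := ad E in
  let G := elementary_group D in
  let fp := fil D 1 in
  let fm := fil D (-1) in
  let om := fp in
  (* (1) *)
  (homogeneous_iso G (H D) conj_act D /\
   (forall s : int, s = 1 \/ s = -1 ->
      homogeneous_iso G (P D (- s)) flag_act (fil D (- s))) /\
   H D = [set g | G g /\ flag_pair_act g (fm, fp) = (fm, fp)] /\
   (forall s : int, s = 1 \/ s = -1 ->
      P D s = [set g | G g /\ flag_act g (fil D s) = fil D s]) /\
   P D 1 `&` P D (-1) = H D /\
   (forall s : int, s = 1 \/ s = -1 ->
      [/\ P D s `&` U D (- s) = [set id],
          P D s = [set g | G g /\ [set ad x | x in gr D s] (conj_act g D \- D)]
        & P D s = [set g | G g /\ msum (center L) (gr D s) (g E - E)]])) /\
  (* (2) *)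
  (set_bij (euler_derivations L) (transversal_pairs L) pair_of /\
   pair_of @` M D = orbit_of G flag_pair_act (fm, fp) /\
   transversal_pairs L `&` (X D 1 `*` X D (-1)) =
     orbit_of G flag_pair_act (fm, fp)) /\
  (* (3) *)
  ((forall e : flag L, X D (-1) e ->
      [/\ transversals e `<=` X D 1,
          affine_space e.1 (transversals e) (fun x f => flag_act (exp_ad x) f)
        & module_iso (gr D 1) e.1]) /\
   transversals om = Vplus D) /\
  (* (4) *)
  (set_bij (gr D 1 `*` H D `*` gr D (-1)) (Omega_plus D)
     (fun p : L * (L -> L) * L => exp_ad p.1.1 \o p.1.2 \o exp_ad p.2) /\
   Omega_plus D = [set g | [/\ G g, GL (gr D 1) (denom D g 0)
                             & GL (gr D (-1)) (codenom D g 0)]]) /\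
  (* (5) *)
  ((forall s : int, s = 1 \/ s = -1 ->
      [/\ X D s `<=` inner_filtrations L,
          stable_under (Aut_gr D) flag_act (X D s)
        & stable_under (ext_elementary_group D) flag_act (X D s)]) /\
   [/\ M D `<=` euler_derivations L,
       stable_under (Aut_gr D) conj_act (M D)
     & stable_under (ext_elementary_group D) conj_act (M D)]).
Proof.
move=> D G fp fm om.
have s1 : sign 1 by left.
have sN : sign (-1) by right.
have Gsub : Aut_subgroup G by exact: elementary_group_subgroup.
have GA g : G g -> Aut L g by case: Gsub => h _ _ _ /h.
have PS s : sign s -> P D s = [set g | G g /\ flag_act g (fil D s) = fil D s].
  by move=> ss; exact: P_stab.
have HS := H_stab two_unit three_unit eulerE s1; rewrite -/D -/fp -/fm in HS.
have pairE g : Aut L g -> pair_of (conj_act g D) = flag_pair_act g (fm, fp).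
  by move=> gA; rewrite /D conj_ad // /pair_of !fil_aut.
have orbit_pair : pair_of @` M D = orbit_of G flag_pair_act (fm, fp).
  apply/seteqP; split=> [_ [_ [g Gg <-] <-]|_ [g Gg <-]].
    by exists g => //; rewrite pairE //; exact: GA.
  by exists (conj_act g D); [exists g|rewrite pairE //; exact: GA].
have Xinner s : sign s -> X D s `<=` inner_filtrations L.
  move=> ss _ [g Gg <-]; apply: inner_aut; first exact: GA.
  by apply: fil_inner => //; exact: sign_opp.
have Hconj : H D = [set g | G g /\ conj_act g D = D].
  apply/seteqP; split=> g [Gg].
    by move=> [gA gD]; split=> //; apply/(conj_act_fixed _ gA).
  move=> gD; split=> //; split; first exact: GA.
  by apply/(conj_act_fixed _ (GA _ Gg)).
have omT : transversals om = Vplus D.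
  exact: (inner_transversal_fil two_unit three_unit eulerE s1).
split; [|split; [|split; [|split]]].
- split; first exact: orbit_stabilizer (conj_action) Gsub Hconj.
  split.
    move=> s ss; apply: orbit_stabilizer => //; first exact: flag_action.
    by apply: PS; exact: sign_opp.
  split.
    rewrite HS; apply/seteqP; split=> g.
      by move=> [Gg g1 g2]; split=> //; rewrite /flag_pair_act /= g1 g2.
    by move=> [Gg [g1 g2 g3 g4]]; split=> //; rewrite /flag_act /= ?g1 ?g2 ?g3 ?g4.
  split; first exact: PS.
  split; first exact: P_capP.
  by move=> s ss; split; [exact: P_capU|exact: P_conj|exact: P_center].
- split.
    split.
    + move=> _ [x ex <-]; split; first exact: fil_inner.
      by split; [exact: fil_inner|exact: fil_transversal].
    + move=> _ _ /set_mem[x ex <-] /set_mem[y ey <-] [a1 a2 b1 b2].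
      by apply: (fil_inj two_unit s1) => //; [congr pair|congr pair].
    + move=> [a b] [/= ai [[_ [x ex <-] <-] ab]].
      have [y ys ->] := transversal_exp two_unit three_unit ex s1 ai ab.
      have yA := exp_aut two_unit three_unit ex s1 ys.
      exists (ad (exp_ad y x)); first by exists (exp_ad y x) => //; exact: euler_aut.
      by rewrite /pair_of !fil_aut // (exp_fil two_unit three_unit ex s1 ys).
  split=> //; apply/seteqP; split=> [[a b]|_ [g Gg <-]].
    move=> [[/= ai [bi ab]] [_ [g Gg /= gb]]].
    have [|k Gk [k1 k2]] := transversal_orbit two_unit three_unit eulerE s1 Gg ai.
      by rewrite -/D -[fil D 1]/(fil D (- -1)) gb.
    by exists k => //; rewrite /flag_pair_act /= -/D k1 k2 -/D -[fil D 1]/(fil D (- -1)) gb.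
  have gA := GA _ Gg; split; last by split; exists g.
  split; first by apply: inner_aut => //; exact: fil_inner.
  split; first by apply: inner_aut => //; exact: fil_inner.
  by apply: transversal_aut => //; apply: transversal_sym; exact: fil_transversal.
- split=> // _ [g Gg <-]; have gA := GA _ Gg.
  rewrite -[fil D (- -1)]/(fil D 1); split.
  + move=> f [fi ft].
    have [k Gk [k1 _]] := transversal_orbit two_unit three_unit eulerE s1 Gg fi ft.
    by exists k.
  + rewrite -(fil_aut _ _ gA).
    exact: (transversals_affine two_unit three_unit (euler_aut gA eulerE)).
  + exists g; split; first by move=> a x y _ _; rewrite (autD gA) (autZ gA).
    split; first by move=> x xs; exists x.
      by move=> x y _ _; exact: (aut_inj gA).
    by move=> _ [x xs <-]; exists x.
- by split; [exact: big_cell|exact: Omega_plus_denominators].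
- split.
    move=> s ss; split; first exact: Xinner.
      move=> a e aG; apply: aut_gr_orbit => //; first exact: flag_action.
      by move=> b; exact: aut_gr_fil.
    by apply: ext_orbit => //; [exact: flag_action|move=> b; exact: aut_gr_fil].
  have fixD b : Aut_gr D b -> conj_act b D = D.
    by move=> [bA bD]; apply/(conj_act_fixed _ bA).
  split.
  + move=> _ [g Gg <-]; rewrite /D conj_ad; last exact: GA.
    by exists (g E) => //; apply: euler_aut => //; exact: GA.
  + by move=> a d aG; apply: aut_gr_orbit => //; exact: conj_action.
  + by apply: ext_orbit => //; exact: conj_action.
Qed.
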